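(* Up to duality and twinness, every edge-biregular map $(H;r_0,r_2,\rho_0,\rho_2)$ on the Klein bottle is defined by a group $H$ with presentation $$H=\langle r_0,r_2,\rho_0,\rho_2\mid r_0^2,r_2^2,\rho_0^2,\rho_2^2,(r_0r_2)^2,(\rho_0\rho_2)^2,(r_0\rho_0)^2,(r_2\rho_2)^2,(r_2\rho_0)^ar_0,(r_0\rho_2)^b\rangle,$$ where $a$ is a positive integer and $b\in\{1,2\}$.
   Context: A map is an embedding of a connected graph in a surface such that each face is homeomorphic to an open disc; semi-edges (edges with only one end attached to a vertex, the other end dangling) are allowed. An alternate-edge-colouring of a map is a colouring of its edges with two colours (shaded, unshaded) such that consecutive edges around every face, and consecutive edges around every vertex, have different colours. Flags are the faces of the barycentric subdivision; a corner is the pair of flags of one face which meet at a corner of that face, and consists of one flag of each colour. A map with an assigned alternate-edge-colouring is edge-biregular if its group $H$ of colour-preserving (and structure-preserving) automorphisms acts regularly on the set of corners. Fixing a marked corner, $H$ is generated by involutions $r_0,r_2,\rho_0,\rho_2$ taking the marked corner to its neighbour respectively along the shaded edge, across the shaded edge, along the unshaded edge, across the unshaded edge. The map is written $(H;r_0,r_2,\rho_0,\rho_2)$; in $H$ one has $(r_0r_2)^2=(\rho_0\rho_2)^2=1$, and the map has type $(k,l)$ (vertex valency $k$, face length $l$) where $r_2\rho_2$ has order $k/2$ and $r_0\rho_0$ has order $l/2$. The group with its four ordered generators determines the map up to isomorphism. The shaded (resp. unshaded) edges are semi-edges when $r_0=r_2$ (resp. $\rho_0=\rho_2$). The twin of $(H;r_0,r_2,\rho_0,\rho_2)$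 is $(H;\rho_0,\rho_2,r_0,r_2)$ (colours switched); its dual is $(H;r_2,r_0,\rho_2,\rho_0)$ (vertices and faces interchanged). *)

(* Defs.v *)
(* A map on a closed surface is encoded by its flags: the faces of the
   barycentric subdivision, together with the three permutations sending each
   flag to the flag with which it shares one of its three sides.  Since the
   surfaces considered are compact, the set of flags is finite. *)
From mathcomp Require Import all_boot all_fingroup.

Set Implicit Arguments.
Unset Strict Implicit.
Unset Printing Implicit Defensive.

Local Open Scope group_scope.

(* [flip0 x], [flip1 x], [flip2 x] are the flags sharing with [x] the side
   opposite to its vertex, edge, face corner respectively: thus [flip0] moves
   along the edge, [flip1] moves to the other edge at the same corner of the
   face, [flip2] moves across the edge.
   - The flips have no fixed flag because the surface has no boundary.
   - The subdivision of an ordinary edge has four flags; a semi-edge has only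
     two, one on each side, because going along it past its dangling end leads
     to its other side: [flip0 x = flip2 x] there.  So [flip0] and [flip2]
     commute, but [flip0 * flip2] may have fixed flags.
   - Transitivity says that the graph, equivalently the surface, is
     connected. *)
Record surface_map (F : finType) := SurfaceMap {
  flip0 : {perm F};
  flip1 : {perm F};
  flip2 : {perm F};
  flip0K : involutive flip0;
  flip1K : involutive flip1;
  flip2K : involutive flip2;
  flip0_free : forall x, flip0 x != x;
  flip1_free : forall x, flip1 x != x;
  flip2_free : forall x, flip2 x != x;
  flip02_comm : forall x, flip0 (flip2 x) = flip2 (flip0 x);
  map_connected :
    [transitive <<[set flip0; flip1; flip2]>>, on [set: F] | 'P] }.

Section Maps.

Variables (F : finType) (M : surface_map F).

Definition vertices : {set {set F}} :=
  orbit 'P <<[set flip1 M; flip2 M]>> @: [set: F].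

Definition edges : {set {set F}} :=
  orbit 'P <<[set flip0 M; flip2 M]>> @: [set: F].

Definition faces : {set {set F}} :=
  orbit 'P <<[set flip0 M; flip1 M]>> @: [set: F].

Definition semi_edges : {set {set F}} :=
  [set e in edges | [exists x in e, flip0 M x == flip2 M x]].

(* The 0-cells of the cell decomposition are the vertices together with the
   dangling ends of the semi-edges.  The equation below is V - E + F = 0. *)
Definition euler_characteristic_zero : Prop :=
  (#|vertices| + #|semi_edges| + #|faces| = #|edges|)%N.

(* An orientation is a choice of a side for each flag such that adjacent flags
   are given opposite sides. *)
Definition orientable : Prop :=
  exists o : {set F}, forall x,
    [/\ (flip0 M x \in o) = (x \notin o),
        (flip1 M x \in o) = (x \notin o) &
        (flip2 M x \in o) = (x \notin o)].

(* By the classification of closed surfaces. *)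
Definition on_klein_bottle : Prop :=
  ~ orientable /\ euler_characteristic_zero.

(* A colouring of the edges is given by the set [S] of all flags lying on a
   shaded edge.  Two edges are consecutive around a face, or around a vertex,
   exactly when they meet at a corner, i.e. when they carry flags [x] and
   [flip1 M x]. *)
Definition alternate_edge_colouring (S : {set F}) : Prop :=
  forall x, [/\ (flip0 M x \in S) = (x \in S),
                (flip2 M x \in S) = (x \in S) &
                (flip1 M x \in S) = (x \notin S)].

Definition corner (x : F) : {set F} := [set x; flip1 M x].

Definition corners : {set {set F}} := corner @: [set: F].

(* The permutations of the flags that commute with the three flips and
   preserve the colours. *)
Definition colour_aut (S : {set F}) : {group {perm F}} :=
  ('C([set flip0 M; flip1 M; flip2 M]) :&: 'N(S | 'P))%G.

(* A regular action is one which is transitive with trivial stabilisers. *)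
Definition edge_biregular (S : {set F}) : Prop :=
  [/\ alternate_edge_colouring S,
      [transitive colour_aut S, on corners | 'P^*] &
      {in corners, forall c, 'C_(colour_aut S)[c | 'P^*] = 1}].

End Maps.

Record quadruple (T : Type) := Quadruple { r0 : T; r2 : T; rho0 : T; rho2 : T }.

Definition twin T (q : quadruple T) : quadruple T :=
  Quadruple (rho0 q) (rho2 q) (r0 q) (r2 q).

Definition dual T (q : quadruple T) : quadruple T :=
  Quadruple (r2 q) (r0 q) (rho2 q) (rho0 q).

Inductive twin_dual_related T (q : quadruple T) : quadruple T -> Prop :=
| TwinDualRefl : twin_dual_related q q
| TwinDualTwin q' : twin_dual_related q q' -> twin_dual_related q (twin q')
| TwinDualDual q' : twin_dual_related q q' -> twin_dual_related q (dual q').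

(* The marked corner is that of the shaded flag [x]; its other flag,
   [flip1 M x], lies on the unshaded edge. *)
Definition distinguished_generators (F : finType) (M : surface_map F) (S : {set F})
    (x : F) (q : quadruple {perm F}) : Prop :=
  [/\ [/\ r0 q \in colour_aut M S, r2 q \in colour_aut M S,
          rho0 q \in colour_aut M S & rho2 q \in colour_aut M S],
      r0 q @: corner M x = corner M (flip0 M x),
      r2 q @: corner M x = corner M (flip2 M x),
      rho0 q @: corner M x = corner M (flip0 M (flip1 M x)) &
      rho2 q @: corner M x = corner M (flip2 M (flip1 M x))].

(* A system of relations between four elements of a group. *)
Definition relations := forall K : groupType, quadruple K -> Prop.

(* [G] has the presentation with generators [q] and relations [R]: it is
   generated by [q], [q] satisfies [R], and [G] maps onto every group, finite
   or not, generated by four elements satisfying [R]. *)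
Definition presented_by (gT : finGroupType) (G : {group gT})
    (q : quadruple gT) (R : relations) : Prop :=
  [/\ G :=: <<[set r0 q; r2 q; rho0 q; rho2 q]>>,
      R gT q &
      forall (K : groupType) (p : quadruple K), R K p ->
        exists f : gT -> K,
          {in G &, {morph f : x y / x * y}} /\
          [/\ f (r0 q) = r0 p, f (r2 q) = r2 p,
              f (rho0 q) = rho0 p & f (rho2 q) = rho2 p]].

Definition klein_relations (a b : nat) : relations := fun K q =>
  let: Quadruple r0 r2 rho0 rho2 := q in
  [/\ [/\ r0 ^+ 2 = 1, r2 ^+ 2 = 1, rho0 ^+ 2 = 1 & rho2 ^+ 2 = 1],
      [/\ (r0 * r2) ^+ 2 = 1, (rho0 * rho2) ^+ 2 = 1,
          (r0 * rho0) ^+ 2 = 1 & (r2 * rho2) ^+ 2 = 1],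
      (r2 * rho0) ^+ a * r0 = 1 &
      (r0 * rho2) ^+ b = 1].

(* Main.v *)
(* Regularity identifies the shaded flags with [H], so each vertex has [4m] flags
   and each face [4n], where [m] and [n] are the orders of [r2 * rho2] and
   [r0 * rho0].  Euler characteristic zero becomes [1/m + 1/n = e/2], where [e]
   is the number of colours whose edges are not semi-edges.  Non-orientability
   means that every generator is a product of an even number of generators.
   - If [e = 1], then [H] is a quotient of the triangle group (2,4,4) or (2,3,6).
     An even word equal to a generator puts a reflection [d] of the point group
     in the abelian group [T] of translations.  If [rho] is the rotation about a
     vertex, the product of [d] with its conjugate by [rho], which is [rho^2],
     also lies in [T], and this collapses [H].
   - If [e = 2], then [m = n = 2] and [H] is a quotient of
     [<r0, rho2> x <r2, rho0>], a direct product of two infinite dihedral groups.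
     An even word equal to a generator yields, up to twin and dual, a reflection
     [r0] lying in [<r2 * rho0>].  Then [rho2] commutes with [r0], so [r0 * rho2]
     has order [b = 1] or [b = 2], and [a] is half the order of [r2 * rho0]. *)
Require Import Defs.
From mathcomp Require Import all_boot all_fingroup cyclic zify.

Set Implicit Arguments.
Unset Strict Implicit.
Unset Printing Implicit Defensive.

Local Open Scope group_scope.

(** * Groups generated by involutions *)

(** In a finite group inverses are powers, so words in [Q] alone exhaust [<<Q>>]. *)
Lemma gen_mulg_ind (gT : finGroupType) (Q : {set gT}) (P : gT -> Prop) :
    P 1 -> (forall a h, a \in Q -> P h -> P (a * h)) ->
  forall h, h \in <<Q>> -> P h.
Proof.
move=> P1 PM h /gen_prodgP[n [c Qc ->]].
elim: n c Qc => [|n IHn] c Qc; first by rewrite big_ord0.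
by rewrite big_ord_recl; apply: PM => //; apply: IHn.
Qed.

(** The Boolean index of [P] records the parity of the length of a word, so that an induction over
    even words can proceed letter by letter. *)
Lemma even_word_ind (gT : finGroupType) (Q : {set gT}) (P : bool -> gT -> Prop) :
    P false 1 -> (forall e a h, a \in Q -> P e h -> P (~~ e) (a * h)) ->
  forall h, h \in <<Q * Q>> -> P false h.
Proof.
move=> P1 PM; apply: gen_mulg_ind => // g h /mulsgP[a b Qa Qb ->] Ph.
by rewrite -mulgA; apply: (PM true); last apply: (PM false).
Qed.

Lemma invol_invg (gT : groupType) (x : gT) : x ^+ 2 = 1 -> x^-1 = x.
Proof. by rewrite expgS expg1 => xx; apply: (mulgI x); rewrite mulgV. Qed.

Lemma invol_mulK (gT : groupType) (x y : gT) : x ^+ 2 = 1 -> x * (x * y) = y.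
Proof. by move/invol_invg => {1}<-; rewrite mulKg. Qed.

Lemma invol_mulgK (gT : groupType) (x y : gT) : x ^+ 2 = 1 -> y * x * x = y.
Proof. by move/invol_invg => {2}<-; rewrite mulgK. Qed.

Lemma invol_expg (gT : groupType) (x : gT) n : x ^+ 2 = 1 -> x ^+ n = x ^+ odd n.
Proof.
move=> x2; rewrite -{1}(odd_double_half n) -muln2 mulnC expgD expgM x2.
by rewrite expg1n mulg1.
Qed.

(** A dihedral group: [<[x]>] has order two, inverts [x * y] and meets [<[x * y]>] trivially. The
    case [x = y] is included. *)
Lemma card_gen_involutions (gT : finGroupType) (x y : gT) :
    x ^+ 2 = 1 -> y ^+ 2 = 1 -> x != 1 -> y != 1 ->
  #|<<[set x; y]>>| = (2 * #[x * y])%N.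
Proof.
move=> x2 y2 x1 y1; have [xV yV] := (invol_invg x2, invol_invg y2).
have xyJ : (x * y) ^ x = (x * y)^-1.
  by rewrite invMg conjgE xV yV -mulgA invol_mulK.
have nxy : <[x]> \subset 'N(<[x * y]>).
  by rewrite cycle_subG; apply/normP; rewrite -cycleJ xyJ cycleV.
have ox : #[x] = 2 by apply: nt_prime_order.
have tixy : <[x]> :&: <[x * y]> = 1.
  (* A power of [x * y] equal to [x] would both centralise and invert [x * y]. Then
     [(x * y) ^+ 2 = 1], so [x] is [1] or [x * y], both excluded. *)
  rewrite prime_TIg -?orderE ?ox //; apply/negP; rewrite cycle_subG => xxy.
  have cx : (x * y) ^ x = x * y.
    apply/conjg_fixP/commgP.
    by case/cycleP: xxy => i {2}->; apply/commuteX.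
  have xy2 : (x * y) ^+ 2 = 1.
    by rewrite expgS expg1 -{1}cx xyJ mulVg.
  case/cycleP: xxy => i; rewrite (invol_expg _ xy2).
  case: odd; rewrite ?expg1 => xE; last by rewrite xE eqxx in x1.
  by move/eqP: xE; rewrite -{1}[x]mulg1 (inj_eq (mulgI x)) eq_sym (negPf y1).
rewrite -[2%N]ox -TI_cardMg // -norm_joinEl //; apply: eq_card => z.
suff -> : <<[set x; y]>> = <[x]> <*> <[x * y]> by [].
have [xJ xyI] : x \in <[x]> <*> <[x * y]> /\ x * y \in <[x]> <*> <[x * y]>.
  by split; rewrite mem_gen // inE cycle_id ?orbT.
have [xG yG] : x \in <<[set x; y]>> /\ y \in <<[set x; y]>>.
  by rewrite !mem_gen // !inE eqxx ?orbT.
apply/eqP; rewrite eqEsubset; apply/andP; split.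
  by rewrite gen_subG subUset !sub1set xJ -(groupMl _ xJ) xyI.
by apply/joing_subP; rewrite !cycle_subG groupM.
Qed.

(* [rho = r * u] is the rotation about a vertex and [T] the group of translations,
   so that even words form [T * <rho>]. *)
Lemma reflection_in_translations (gT : finGroupType) (r s u t : gT) (j : nat)
    (T := <[t]> <*> <[t ^ (r * u)]>) :
    r ^+ 2 = 1 -> u ^+ 2 = 1 -> s * u = t * (r * u) ^+ j ->
    t ^ u = t -> t ^ (r * u) ^+ 2 \in T ->
    r \in <<[set r; s; u] * [set r; s; u]>> ->
  exists d, [/\ d \in T, d ^+ 2 = 1, (r * u) ^ d = (r * u)^-1,
                d * d ^ (r * u) = (r * u) ^+ 2 & (r * u) ^+ 2 \in T].
Proof.
rewrite {}/T; set rho := r * u; move=> r2 u2 suE tu trho2; set T := _ <*> _.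
have [rV uV] := (invol_invg r2, invol_invg u2).
have rhor : rho ^ r = rho^-1 by rewrite conjgE invMg rV uV -mulgA invol_mulK.
have rhou : rho ^ u = rho^-1 by rewrite conjgE invMg rV uV invol_mulgK.
have rE : r = rho * u by rewrite /rho invol_mulgK.
have sE : s = t * rho ^+ j * u by rewrite -suE invol_mulgK.
clearbody rho.
have [tT trT] : t \in T /\ t ^ rho \in T.
  by split; rewrite mem_gen // inE cycle_id ?orbT.
have nT (g : gT) : t ^ g \in T -> (t ^ rho) ^ g \in T -> g \in 'N(T).
  move=> tg trg; rewrite inE -genJ gen_subG conjUg subUset -!cycleJ.
  by rewrite !cycle_subG tg.
have rhoN : rho \in 'N(T) by apply: nT => //; rewrite -conjgM.
have uN : u \in 'N(T).
  apply: nT; first by rewrite tu.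
  by rewrite -conjgM [rho * u]conjgC conjgM tu rhou memJ_norm // groupV.
(* Normal form of words of parity [e]: an element of [T], a rotation about the vertex, and the
   reflection [u] if the word is odd. *)
pose P (e : bool) (h : gT) := exists t' i, t' \in T /\ h = t' * rho ^+ i * u ^+ e.
have Pt e h : P e h -> P e (t * h).
  by case=> t' [i [tT' ->]]; exists (t * t'), i; rewrite !mulgA groupM.
have Prho e h : P e h -> P e (rho * h).
  case=> t' [i [tT' ->]]; exists (t' ^ rho^-1), i.+1.
  rewrite memJ_norm ?groupV //; split=> //.
  by rewrite conjgE invgK expgS !mulgA mulgKV.
have Pu e h : P e h -> P (~~ e) (u * h).
  (* [u] inverts [rho]; the exponent [#[rho].-1] writes [rho^-1] as a natural power. *)
  case=> t' [i [tT' ->]]; exists (t' ^ u), (i * #[rho].-1)%N.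
  rewrite memJ_norm //; split=> //.
  rewrite mulnC expgM -invg_expg -rhou -conjXg !conjgE uV.
  have -> : u ^+ (~~ e) = u * u ^+ e by case: e; rewrite ?mulg1.
  by rewrite !mulgA !(invol_mulgK _ u2).
move/(even_word_ind (P := P)); case=> [||t' [i [tT' rtE]]].
- by exists 1, 0; rewrite group1 !mulg1.
- move=> e a h; rewrite !inE => /orP[/orP[]|] /eqP -> Ph; last exact: Pu.
    by rewrite rE -mulgA; apply/Prho/Pu.
  rewrite sE -!mulgA; apply: Pt; elim: (j) => [|i IHi]; first by rewrite mul1g; apply: Pu.
  by rewrite expgS -mulgA; apply: Prho.
(* Being even, [r] equals [t' * rho ^+ i], so [t' = r * rho ^- i] lies in [T] and is also a
   reflection inverting [rho]. *)
rewrite mulg1 in rtE; exists t'.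
have t'E : t' = r * rho ^- i by rewrite rtE mulgK.
have rhoJ : rho ^ t' = rho^-1.
  by rewrite t'E conjgM rhor conjVg conjgE invgK mulgA -expgSr expgS mulgK.
have t'2 : t' ^+ 2 = 1.
  rewrite expgS expg1 {1}t'E -mulgA [_ * t']conjgC conjVg conjXg rhoJ expVgn invgK.
  by rewrite t'E mulgVK -[r * r]/(r ^+ 2).
have t'J : t' * t' ^ rho = rho ^+ 2.
  rewrite conjgE -{1}(invol_invg t'2) !mulgA -[t'^-1 * _ * t']mulgA.
  by rewrite -conjgE conjVg rhoJ invgK.
by split; rewrite // -t'J groupM ?memJ_norm.
Qed.

(** * Euclidean triangle groups *)

Lemma abelian_joing_cycle (gT : finGroupType) (x y : gT) :
  commute x y -> abelian (<[x]> <*> <[y]>).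
Proof.
move=> cxy; rewrite abelianY !cycle_abelian cent_cycle cycle_subG.
by apply/cent1P.
Qed.

(** [t] is the product of the half-turns [e] and [rho ^+ 3], hence a translation. The conclusion is
    the identity 1 + w^2 = w for a primitive sixth root of unity w, in both orders of the product,
    which also yields commutativity. *)
Lemma translations_236 (gT : finGroupType) (rho e : gT) (t := e * rho ^+ 3) :
    e ^+ 2 = 1 -> (rho * e) ^+ 3 = 1 -> rho ^+ 6 = 1 ->
  t ^ rho ^+ 2 * t = t ^ rho /\ t * t ^ rho ^+ 2 = t ^ rho.
Proof.
move=> e2; set c := rho * e => c3 rho6; have eV := invol_invg e2.
have rhoE : rho = c * e by rewrite invol_mulgK.
have rhoV : rho^-1 = e * c ^+ 2.
  by apply: (mulgI rho); rewrite mulgV rhoE mulgA invol_mulgK // -expgS.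
have rho3V : rho ^- 3 = rho ^+ 3 by apply: invol_invg; rewrite -expgM.
clearbody c; rewrite /t; set t' := e * _.
(* All elements become words in [e] and [c], which [eK] and [cK] reduce by means of [e ^+ 2 = 1] and
   [c ^+ 3 = 1]. *)
have eK z : e * (e * z) = z by rewrite invol_mulK.
have cK z : c * (c * (c * z)) = z.
  by rewrite !mulgA -[c * c * c]/(c * c ^+ 1 * c ^+ 1) -!expgS -expgSr c3 mul1g.
have t'E : t' = e * rho^-1 * rho^-1 * rho^-1.
  by rewrite /t' -rho3V -expgVn !mulgA.
have t1E : t' ^ rho = rho^-1 * e * rho^-1 * rho^-1.
  by rewrite t'E conjgE !mulgA mulgVK.
have t2E : t' ^ rho ^+ 2 = rho^-1 * rho^-1 * e * rho^-1.
  by rewrite t'E conjgE invMg !mulgA !mulgVK.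
rewrite t1E t2E; split.
  by rewrite t'E rhoV -!mulgA !(eK, cK).
by rewrite /t' rhoV rhoE !(expgS, expg0, mulg1) -!mulgA !(eK, cK).
Qed.

(** [t] is the product of the half-turns [e] and [rho ^+ 2]. The quarter-turn [rho] acts on
    translations like multiplication by i, so its square inverts them. *)
Lemma translations_244 (gT : finGroupType) (rho e : gT) (t := e * rho ^+ 2) :
    e ^+ 2 = 1 -> (rho * e) ^+ 4 = 1 -> rho ^+ 4 = 1 ->
  t ^ rho ^+ 2 = t^-1 /\ commute t (t ^ rho).
Proof.
move=> e2; set c := rho * e => c4 rho4; have eV := invol_invg e2.
have rhoE : rho = c * e by rewrite invol_mulgK.
have rhoV : rho^-1 = e * c ^+ 3.
  by apply: (mulgI rho); rewrite mulgV rhoE mulgA invol_mulgK // -expgS.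
have rho2V : rho ^- 2 = rho ^+ 2 by apply: invol_invg; rewrite -expgM.
clearbody c; rewrite /t; set t' := e * _.
have eK z : e * (e * z) = z by rewrite invol_mulK.
have cK z : c * (c * (c * (c * z))) = z.
  by rewrite -[RHS]mul1g -c4 !expgS expg0 mulg1 !mulgA.
have t'E : t' = e * rho^-1 * rho^-1.
  by rewrite /t' -rho2V -expgVn !mulgA.
split.
  by rewrite /t' conjgE rho2V invMg rho2V eV -[e * _ * _]mulgA -expgD rho4 mulg1.
have t1E : t' ^ rho = rho^-1 * e * rho^-1 by rewrite t'E conjgE !mulgA mulgVK.
rewrite /commute t1E {1}/t' t'E rhoV !(expgS, expg0, mulg1) rhoE -!mulgA.
by rewrite !(eK, cK).
Qed.

(** Otherwise the abelian group [T] contains both [rho ^+ 2] and an element [d] inverting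
    [rho = r * u]. Then [rho ^+ 2] is its own inverse, so the order of [rho] divides 4 and is not
    6. *)
Lemma triangle_236_orientable (gT : finGroupType) (r s u : gT) :
    r ^+ 2 = 1 -> s ^+ 2 = 1 -> u ^+ 2 = 1 -> (s * u) ^+ 2 = 1 ->
    #[r * u] = 6 -> #[r * s] = 3 ->
  r \notin <<[set r; s; u] * [set r; s; u]>>.
Proof.
move=> r2 s2 u2 su2 oru ors; apply/negP => rE.
have [[rV sV] uV] := (invol_invg r2, invol_invg s2, invol_invg u2).
have suV := invol_invg su2; have usE : u * s = s * u by rewrite -suV invMg sV uV.
pose rho := r * u; pose e := s * u.
have rhoeE : rho * e = r * s by rewrite /rho /e -usE mulgA invol_mulgK.
have rhoe3 : (rho * e) ^+ 3 = 1 by rewrite rhoeE -ors expg_order.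
have rho6 : rho ^+ 6 = 1 by rewrite -oru expg_order.
have rhou : rho ^ u = rho^-1 by rewrite conjgE invMg rV uV invol_mulgK.
have eu : e ^ u = e by rewrite conjgE uV /e invol_mulgK.
pose t := e * rho ^+ 3.
have eE : e = t * rho ^+ 3 by rewrite /t -mulgA -expgD rho6 mulg1.
have rho3V : rho ^- 3 = rho ^+ 3 by apply: invol_invg; rewrite -expgM.
have tu : t ^ u = t by rewrite /t conjMg eu conjXg rhou expVgn rho3V.
have [rel1 rel2] := translations_236 su2 rhoe3 rho6.
have Tab : abelian (<[t]> <*> <[t ^ rho]>).
  apply: abelian_joing_cycle; rewrite -[X in commute t X]rel1.
  by rewrite /commute mulgA rel2 rel1.
have [] := reflection_in_translations (j := 3) r2 u2 eE tu _ rE.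
  by rewrite -[t ^ _](mulgK t) rel1 groupM // ?groupV mem_gen // inE cycle_id ?orbT.
move=> d [Td d2 rhod _ Trho2].
have /commgP/conjg_fixP := centsP Tab _ Trho2 _ Td.
rewrite conjXg rhod => rho2V; suff : #[r * u] %| 4 by rewrite oru.
rewrite order_dvdn -/rho (expgD _ 2 2) -{1}rho2V -expgMn ?mulVg ?expg1n //.
exact/commute_sym/commuteV.
Qed.

(** Here [rho ^+ 4 = 1] is no contradiction. Instead [T] collapses to an elementary abelian 2-group,
    and this forces [(r * s) ^+ 2 = 1]. *)
Lemma triangle_244_orientable (gT : finGroupType) (r s u : gT) :
    r ^+ 2 = 1 -> s ^+ 2 = 1 -> u ^+ 2 = 1 -> (s * u) ^+ 2 = 1 ->
    #[r * u] = 4 -> #[r * s] = 4 ->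
  r \notin <<[set r; s; u] * [set r; s; u]>>.
Proof.
move=> r2 s2 u2 su2 oru ors; apply/negP => rE.
have [[rV sV] uV] := (invol_invg r2, invol_invg s2, invol_invg u2).
have suV := invol_invg su2; have usE : u * s = s * u by rewrite -suV invMg sV uV.
pose rho := r * u; pose e := s * u.
have rhoeE : rho * e = r * s by rewrite /rho /e -usE mulgA invol_mulgK.
have rhoe4 : (rho * e) ^+ 4 = 1 by rewrite rhoeE -ors expg_order.
have rho4 : rho ^+ 4 = 1 by rewrite -oru expg_order.
have rho2_neq1 : rho ^+ 2 != 1 by rewrite -order_dvdn oru.
have rhou : rho ^ u = rho^-1 by rewrite conjgE invMg rV uV invol_mulgK.
have eu : e ^ u = e by rewrite conjgE uV /e invol_mulgK.
pose t := e * rho ^+ 2.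
have eE : e = t * rho ^+ 2 by rewrite /t -mulgA -expgD rho4 mulg1.
have rho2V : rho ^- 2 = rho ^+ 2 by apply: invol_invg; rewrite -expgM.
have tu : t ^ u = t by rewrite /t conjMg eu conjXg rhou expVgn rho2V.
have [tJ tC] := translations_244 su2 rhoe4 rho4.
have Tab := abelian_joing_cycle tC.
have tT : t \in <[t]> <*> <[t ^ rho]> by rewrite mem_gen // inE cycle_id.
have [] := reflection_in_translations (j := 2) r2 u2 eE tu _ rE.
  by rewrite tJ groupV.
move=> d [Td d2 rhod ddrho Trho2].
(* Conjugation by [rho ^+ 2] inverts [t], but [rho ^+ 2] lies in the abelian group [T]. *)
have tV : t^-1 = t.
  by rewrite -tJ; apply/conjg_fixP/commgP; apply: (centsP Tab).
have t2 : t ^+ 2 = 1 by rewrite -(mulgV t) tV.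
have t12 : (t ^ rho) ^+ 2 = 1 by rewrite -conjXg t2 conj1g.
have t1J : (t ^ rho) ^ rho = t by rewrite -conjgM tJ.
(* Since [d * d ^ rho = rho ^+ 2] is not [1], [rho] does not centralise [d]. Among the four products
   of powers of [t] and [t ^ rho] this leaves [d = t] or [d = t ^ rho]. *)
have rho2E : rho ^+ 2 = t * t ^ rho.
  have : d \in <[t]> * <[t ^ rho]>.
    by rewrite -cent_joinEr // cent_cycle cycle_subG; apply/cent1P.
  case/mulsgP=> _ _ /cycleP[i ->] /cycleP[j ->].
  rewrite (invol_expg i t2) (invol_expg j t12) => dE.
  have drho : d ^ rho != d.
    apply: contraNneq rho2_neq1 => drho.
    by rewrite -ddrho -/rho drho -[d * d]/(d ^+ 2) d2.
  move: ddrho drho; rewrite -/rho => <-; rewrite dE.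
  case: (odd i) (odd j) => [] [] /=; rewrite ?mul1g ?mulg1 ?conj1g ?eqxx ?expg1 //.
    by rewrite conjMg t1J tC eqxx.
  by rewrite t1J tC.
suff : #[r * s] %| 2 by rewrite ors.
rewrite order_dvdn -rhoeE.
have et1 : e = t ^ rho by rewrite eE rho2E mulgA -[t * t]/(t ^+ 2) t2 mul1g.
have sqrM (y z : gT) : (y * z) ^+ 2 = y ^+ 2 * (z ^ y * z).
  by rewrite conjgE !expgS !expg0 !mulg1 !mulgA mulgK.
by rewrite sqrM et1 t1J -rho2E -expgD rho4.
Qed.

(** * The presentation *)

(** The first Boolean is the colour ([true] for unshaded), the second the direction ([true] for
    across the edge). With letters as indices, one word can be evaluated in several groups. *)
Definition letter T (q : quadruple T) (i : bool * bool) : T :=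
  match i with
  | (false, false) => r0 q
  | (false, true) => r2 q
  | (true, false) => rho0 q
  | (true, true) => rho2 q
  end.

Lemma commute_invol (gT : groupType) (x y : gT) :
  x ^+ 2 = 1 -> y ^+ 2 = 1 -> (x * y) ^+ 2 = 1 -> commute x y.
Proof. by move=> x2 y2 /invol_invg; rewrite invMg !invol_invg. Qed.

Lemma invol_commute (gT : groupType) (x y : gT) :
  x ^+ 2 = 1 -> y ^+ 2 = 1 -> commute x y -> (x * y) ^+ 2 = 1.
Proof. by move=> x2 y2 cxy; rewrite expgMn // x2 y2 mulg1. Qed.

Lemma klein_r0E (gT : groupType) (a b : nat) (q : quadruple gT) :
  klein_relations a b q -> r0 q = (r2 q * rho0 q) ^+ a.
Proof.
case: q => r0 r2 rho0 rho2 [[r02 _ _ _] _ rel _] /=.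
by rewrite -(invol_invg r02) -[RHS](mulgK r0) rel mul1g.
Qed.

(** With [t = r2 * rho0], [r0] is a power of [t], [r2] inverts [t], and [rho2] commutes with [t] and
    [r2]. The exponents are chosen before the group [K], so that the values of a word in two groups
    can be compared. *)
Lemma klein_word_normal (a b : nat) (w : seq (bool * bool)) : (0 < a)%N ->
  exists (i : nat) (j k : bool), forall (K : groupType) (p : quadruple K),
    klein_relations a b p ->
    \prod_(l <- w) letter p l = (r2 p * rho0 p) ^+ i * r2 p ^+ j * rho2 p ^+ k.
Proof.
move=> a_gt0; elim: w => [|l w [i [j [k IHw]]]].
  by exists 0, false, false => K p _; rewrite big_nil !mulg1.
(* As [t ^+ (2 * a) = r0 ^+ 2 = 1], the factor [(2 * a).-1] inverts a power of [t]. The case of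
   [rho0] comes from [rho0 = r2 * t]. *)
pose i' := match l with
  | (false, false) => a + i
  | (false, true) => i * (2 * a).-1
  | (true, false) => i.+1 * (2 * a).-1
  | (true, true) => i
  end%N.
pose j' := (l \in [:: (false, true); (true, false)]) (+) j.
pose k' := (l == (true, true)) (+) k.
exists i', j', k' => K p pR; rewrite big_cons (IHw K p pR) {IHw}.
have r0E := klein_r0E pR.
case: p pR r0E => s0 s2 u0 u2 [[s02 s22 u02 u22] [_ u0u2 _ s2u2] _ _] /= s0E.
set t := s2 * u0 in s0E *.
have tJ : t ^ s2 = t^-1.
  by rewrite conjgE invMg (invol_invg s22) (invol_invg u02) -mulgA invol_mulK.
have tV n : t ^- n = t ^+ (n * (2 * a).-1).
  apply: (mulgI (t ^+ n)); rewrite mulgV -expgD -mulnS prednK ?muln_gt0 //.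
  by rewrite mulnC [(2 * a)%N]mulnC -mulnA expgM -s0E expgM s02 expg1n.
have s2t n : s2 * t ^+ n = t ^- n * s2.
  by rewrite [RHS]conjgC conjVg conjXg tJ expVgn invgK.
have u2t n : commute u2 (t ^+ n).
  by apply/commuteX/commuteM; apply: commute_sym; apply: commute_invol.
have u2s n : commute u2 (s2 ^+ n) by apply/commuteX/commute_sym/commute_invol.
have sb (x : K) n : x ^+ 2 = 1 -> x * x ^+ (n : bool) = x ^+ (~~ n).
  by case: n => x2; [exact: x2 | rewrite /= ; rewrite  expg0 mulg1].
rewrite {}/i' {}/j' {}/k'; rewrite !inE -!mulgA; case: l => [] [] [] /=.
- by rewrite -(sb u2) // mulgA u2t -mulgA [u2 * (_ * _)]mulgA u2s -mulgA.
- rewrite -tV -(sb s2) // !mulgA -s2t -!mulgA expgS /t !mulgA.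
  by rewrite -[s2 * s2]/(s2 ^+ 2) s22 mul1g.
- by rewrite -tV -(sb s2) // !mulgA -s2t.
by rewrite s0E expgD !mulgA.
Qed.

Definition generators (T : finType) (q : quadruple T) : {set T} :=
  [set r0 q; r2 q; rho0 q; rho2 q].

Lemma letterP (gT : finType) (q : quadruple gT) (g : gT) :
  reflect (exists l, g = letter q l) (g \in generators q).
Proof.
rewrite !inE; apply: (iffP idP).
  case/orP=> [/orP[/orP[]|]|] /eqP->.
  - by exists (false, false).
  - by exists (false, true).
  - by exists (true, false).
  by exists (true, true).
by case=> -[[] []] -> /=; rewrite eqxx ?orbT.
Qed.

Lemma word_invol_inv (K : groupType) (p : quadruple K) (w : seq (bool * bool)) :
    (forall l, letter p l ^+ 2 = 1) ->
  \prod_(l <- rev w) letter p l = (\prod_(l <- w) letter p l)^-1.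
Proof.
move=> p2; elim: w => [|l w IHw]; first by rewrite !big_nil invg1.
by rewrite rev_cons -cats1 big_cat big_seq1 big_cons invMg (invol_invg (p2 l)) IHw.
Qed.

Lemma gen_wordP (gT : finGroupType) (q : quadruple gT) (g : gT) :
  g \in <<generators q>> -> exists w, g = \prod_(l <- w) letter q l.
Proof.
move: g; apply: gen_mulg_ind => [|_ h /letterP[l ->] [w ->]].
  by exists [::]; rewrite big_nil.
by exists (l :: w); rewrite big_cons.
Qed.

Lemma relations_letter2 (K : groupType) (a b : nat) (p : quadruple K) l :
  klein_relations a b p -> letter p l ^+ 2 = 1.
Proof. by case: p => s0 s2 u0 u2 [[? ? ? ?] _ _ _]; case: l => [[] []]. Qed.

(** Von Dyck's argument: if every word trivial in [G] is trivial at each [p] satisfying the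
    relations, then evaluation of words at [p] factors through [G]. *)
Lemma presented_by_klein (gT : finGroupType) (G : {group gT}) (q : quadruple gT)
    (a b : nat) :
    G :=: <<generators q>> -> klein_relations a b q ->
    (forall w, \prod_(l <- w) letter q l = 1 ->
       forall (K : groupType) (p : quadruple K), klein_relations a b p ->
       \prod_(l <- w) letter p l = 1) ->
  presented_by G q (klein_relations a b).
Proof.
move=> GE qR words; split=> // K p pR.
have eq_words w1 w2 : \prod_(l <- w1) letter q l = \prod_(l <- w2) letter q l ->
    \prod_(l <- w1) letter p l = \prod_(l <- w2) letter p l.
  move=> w12; apply: (mulIg (\prod_(l <- w2) letter p l)^-1).
  rewrite mulgV -word_invol_inv => [|l]; last exact: relations_letter2 pR.
  rewrite -big_cat; apply: (words) pR; rewrite big_cat /= w12.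
  by rewrite word_invol_inv ?mulgV // => l; apply: relations_letter2 qR.
(* [f] evaluates at [p] a chosen word for each element of [G]; outside [G] it takes the default
   value [1]. *)
have [f fE] : exists f : gT -> K, forall g, g \in G ->
    exists w, g = \prod_(l <- w) letter q l /\ f g = \prod_(l <- w) letter p l.
  apply: (@fin_all_exists gT (fun=> K) (fun g y => g \in G -> exists w, _ /\ y = _)).
  move=> g; have [|gG] := boolP (g \in G); last by exists 1.
  rewrite GE => /gen_wordP[w ->].
  by exists (\prod_(l <- w) letter p l) => _; exists w.
have fM : {in G &, {morph f : x y / x * y}}.
  move=> x y xG yG.
  have [w1 [xE ->]] := fE _ xG; have [w2 [yE ->]] := fE _ yG.
  have [w [xyE ->]] := fE _ (groupM xG yG).
  by rewrite -big_cat; apply: eq_words; rewrite -xyE big_cat /= -xE -yE.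
have f_letter l : f (letter q l) = letter p l.
  have lG : letter q l \in G by rewrite GE mem_gen //; apply/letterP; exists l.
  have [w [lE ->]] := fE _ lG; have := eq_words w [:: l].
  by rewrite !big_seq1 -lE; apply.
exists f; split=> //; split.
- exact: (f_letter (false, false)).
- exact: (f_letter (false, true)).
- exact: (f_letter (true, false)).
exact: (f_letter (true, true)).
Qed.

(* The quotients of [<r0, rho2> x <r2, rho0>], with infinite dihedral factors, in
   which the stabilisers of the vertices, edges and faces do not collapse. *)
Definition square_lattice_quotient (gT : finGroupType) (q : quadruple gT) : Prop :=
  [/\ forall l, letter q l ^+ 2 = 1 /\ letter q l != 1,
      [/\ commute (r0 q) (r2 q), commute (rho0 q) (rho2 q),
          commute (r0 q) (rho0 q) & commute (r2 q) (rho2 q)] &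
      [/\ r0 q != r2 q, rho0 q != rho2 q, r0 q != rho0 q & r2 q != rho2 q]].

Lemma square_twin (gT : finGroupType) (q : quadruple gT) :
  square_lattice_quotient q -> square_lattice_quotient (twin q).
Proof.
case=> lP [c1 c2 c3 c4] [n1 n2 n3 n4]; split.
- by case=> [[] []]; [apply: (lP (false, true)) | apply: (lP (false, false))
                    | apply: (lP (true, true)) | apply: (lP (true, false))].
- by split=> //; apply: commute_sym.
by split=> //; rewrite eq_sym.
Qed.

Lemma square_dual (gT : finGroupType) (q : quadruple gT) :
  square_lattice_quotient q -> square_lattice_quotient (dual q).
Proof.
case=> lP [c1 c2 c3 c4] [n1 n2 n3 n4]; split.
- by case=> [[] []]; [apply: (lP (true, false)) | apply: (lP (true, true))
                    | apply: (lP (false, false)) | apply: (lP (false, true))].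
- by split=> //; apply: commute_sym.
by split=> //; rewrite eq_sym.
Qed.

(** A word trivial in [G] is put in normal form [t ^+ i * s2 ^+ j * u2 ^+ k]. For each [j] and [k],
    either this cannot be [1] in [G], or the relations make it [1] in every group. *)
Lemma square_presentation (gT : finGroupType) (G : {group gT}) (q : quadruple gT) :
    G :=: <<generators q>> -> square_lattice_quotient q ->
    r0 q \in <[r2 q * rho0 q]> ->
  exists a b, [/\ (0 < a)%N, b \in [:: 1; 2]%N &
                  presented_by G q (klein_relations a b)].
Proof.
case: q => s0 s2 u0 u2 GE [lP [/= c02 cu c0 c2] [/= s02 u02 su0 su2]] st.
have [s0_2 s0_1] := lP (false, false); have [s2_2 s2_1] := lP (false, true).
have [u0_2 _] := lP (true, false); have [u2_2 u2_1] := lP (true, true).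
move: s0_2 s0_1 s2_2 s2_1 u0_2 u2_2 u2_1 => /= s0_2 s0_1 s2_2 s2_1 u0_2 u2_2 u2_1.
set t := s2 * u0 in st.
have /cyclePmin[a a_lt s0E] := st.
have a_gt0 : (0 < a)%N by case: a s0E s0_1 {a_lt} => // ->; rewrite eqxx.
have ot : #[t] = (2 * a)%N.
  (* [2 * a] is a positive multiple of [#[t]] and is less than [2 * #[t]]. *)
  have /dvdnP[[|[|m]] am] : #[t] %| 2 * a by rewrite order_dvdn mulnC expgM -s0E s0_2.
  - by move/eqP: am; rewrite muln_eq0 /= -leqn0 leqNgt a_gt0.
  - by rewrite am mul1n.
  suff : (2 * #[t] <= 2 * a)%N by rewrite leq_mul2l leqNgt a_lt.
  by rewrite am leq_mul2r orbT.
(* So [b] is the order of [s0 * u2]. *)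
pose b := (s0 != u2).+1.
exists a, b; split=> //; first by rewrite /b; case: eqP.
have ct2 : commute u2 t by apply: commuteM; apply: commute_sym.
have qR : klein_relations a b (Quadruple s0 s2 u0 u2).
  split; first by split.
  - by split; apply: invol_commute.
  - by rewrite -/t -s0E.
  rewrite /b; case: eqP => [->|_]; first by rewrite expg1 -[RHS]u2_2.
  by apply: invol_commute => //; rewrite s0E; apply/commute_sym/commuteX.
apply: presented_by_klein => // w wE K p pR.
have [i [j [k wN]]] := klein_word_normal b w a_gt0.
move: wE; rewrite (wN _ _ qR) (wN _ _ pR) {wN w} /= -/t.
have tJ : t ^ s2 = t^-1.
  by rewrite conjgE invMg (invol_invg s2_2) (invol_invg u0_2) -mulgA invol_mulK.
have r0E := klein_r0E pR; have r02 := relations_letter2 (false, false) pR.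
have dvd_t m : #[t] %| m -> (r2 p * rho0 p) ^+ m = 1.
  rewrite ot => /dvdnP[z ->]; rewrite mulnC [(2 * a)%N]mulnC -mulnA.
  by rewrite expgM -r0E expgM r02 expg1n.
(* [s2] inverts [t]; if it also commutes with [t], then [#[t] = 2 * a] divides 2 and [a = 1]. *)
have s2t : commute s2 t -> t = s0.
  move=> /commute_sym/commgP/conjg_fixP; rewrite tJ => tV.
  have : #[t] %| 2 by rewrite order_dvdn expgS expg1 -{1}tV mulVg.
  rewrite ot => /(dvdn_leq (ltn0Sn 1)); rewrite -{2}[2%N]muln1 leq_pmul2l // => a_le1.
  by rewrite s0E (_ : a = 1%N) //; apply/eqP; rewrite eqn_leq a_le1.
have s2_t : s2 \notin <[t]>.
  apply/negP => s2_t; have ts0 : t = s0.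
    by apply: s2t; case/cycleP: s2_t => z ->; apply/commute_sym/commuteX.
  case/cycleP: s2_t => z; rewrite ts0 (invol_expg z s0_2).
  by case: odd => /eqP; rewrite ?(negPf s2_1) // eq_sym (negPf s02).
case: k.
  (* With [j = k = 1], [s2] lies in [<[t]> * u2] and commutes with [t], whence [t = s0]. Then
     [u0 = u2] or [s2 = u2] according to the parity of [i]. *)
  rewrite !expg1; case: j => [|]; rewrite ?expg1 ?mulg1 => wE.
    have s2E : s2 = t ^- i * u2.
      by apply: (mulgI (t ^+ i)); rewrite mulgA mulgV mul1g -[u2]mul1g -wE invol_mulgK.
    have ts0 : t = s0.
      apply: s2t; rewrite s2E; apply/commute_sym/commuteM => //.
      by apply/commuteV/commuteX.
    move: wE; rewrite ts0 (invol_expg i s0_2); case: odd; rewrite ?expg1 ?mul1g.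
      rewrite c02 -ts0 invol_mulK // => /(canRL (mulgK _)) /eqP.
      by rewrite mul1g (invol_invg u2_2) (negPf u02).
    move/(canRL (mulgK _)); rewrite mul1g (invol_invg u2_2) => /eqP.
    by rewrite (negPf su2).
  (* The only involution in [<[t]>] is [t ^+ a = s0], so [u2 = s0] and [b = 1]; the last relation
     then kills the word in [K]. *)
  have u2E : u2 = t ^+ i.
    by rewrite -(invol_invg u2_2); apply: (mulIg u2); rewrite mulVg wE.
  have : #[t] %| 2 * i by rewrite order_dvdn mulnC expgM -u2E u2_2.
  rewrite ot dvdn_pmul2l // => /dvdnP[m iE].
  have : s0 ^+ m = u2 by rewrite u2E iE mulnC expgM s0E.
  rewrite iE mulnC expgM -r0E (invol_expg m s0_2) (invol_expg m r02).
  case: odd => [|/eqP]; last by rewrite eq_sym (negPf u2_1).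
  rewrite !expg1 => s0u2; case: p pR {r0E r02 dvd_t} => ? ? ? ? [_ _ _].
  by rewrite /b s0u2 eqxx.
rewrite !mulg1; case: j => [wE|]; last first.
  by rewrite !mulg1 => /eqP; rewrite -order_dvdn; apply: dvd_t.
by case/negP: s2_t; rewrite -(groupMl _ (mem_cycle t i)) wE group1.
Qed.

(** * Even words equal to a generator *)

(** [z * x] is a reflection of the dihedral group generated by [x] and [y], hence a conjugate of [x]
    or [y] under that group, which normalises [C]. The induction lowers the exponent by two,
    conjugating by [y * x]. *)
Lemma reflection_mem (gT : finGroupType) (x y z : gT) (C : {group gT}) :
    x ^+ 2 = 1 -> y ^+ 2 = 1 -> x \in 'N(C) -> y \in 'N(C) ->
    z \in <[x * y]> -> z * x \in C ->
  x \in C \/ y \in C.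
Proof.
move=> x2 y2 xN yN /cycleP[n ->]; have [m] := ubnP n; elim: m n => // m IHm.
have [xV yV] := (invol_invg x2, invol_invg y2).
case=> [|[|n]] /ltnSE le_n_m; first by rewrite mul1g; left.
  have -> : x * y * x = y ^ x by rewrite conjgE xV mulgA.
  by rewrite memJ_norm //; right.
have -> : (x * y) ^+ n.+2 * x = ((x * y) ^+ n * x) ^ (y * x).
  by rewrite conjgE invMg xV yV expgS expgSr !mulgA.
by rewrite memJ_norm; [apply/IHm/ltnW | apply: groupM].
Qed.

Lemma invol_mulC (gT : finGroupType) (x t z : gT) :
  x ^+ 2 = 1 -> t ^ x = t^-1 -> z \in <[t]> -> x * z = z^-1 * x.
Proof.
move=> /invol_invg xV tx /cycleP[n ->].
by rewrite conjgCV xV conjXg tx expVgn.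
Qed.

(** Comparing the two dihedral factors places one of the four generators in the rotation subgroup of
    the other factor; twin and dual move that generator to the place of [r0]. *)
Lemma square_nonorientable (gT : finGroupType) (q : quadruple gT) :
    square_lattice_quotient q -> r0 q \in <<generators q * generators q>> ->
  exists q', [/\ twin_dual_related q q', square_lattice_quotient q',
    generators q' = generators q & r0 q' \in <[r2 q' * rho0 q']>].
Proof.
move=> qS; have [lP [/= c02 cu c0 c2] _] := qS.
have [s02 _] := lP (false, false); have [s22 _] := lP (false, true).
have [u02 _] := lP (true, false); have [u22 _] := lP (true, true).
have genT p : generators (twin p) = generators p.
  by apply/setP=> g; rewrite !inE; do !case: eqP => //=.
have genD p : generators (dual p) = generators p.
  by apply/setP=> g; rewrite !inE; do !case: eqP => //=.
case: q qS lP c02 cu c0 c2 s02 s22 u02 u22 => s0 s2 u0 u2 /=.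
move=> qS lP c02 cu c0 c2 s02 s22 u02 u22; pose t := s2 * u0; pose v := s0 * u2.
have tJ : t ^ s2 = t^-1.
  by rewrite conjgE invMg (invol_invg s22) (invol_invg u02) -mulgA invol_mulK.
have vJ : v ^ s0 = v^-1.
  by rewrite conjgE invMg (invol_invg s02) (invol_invg u22) -mulgA invol_mulK.
have s0t z : z \in <[t]> -> commute s0 z.
  by case/cycleP=> n ->; apply/commuteX/commuteM.
have u2t z : z \in <[t]> -> commute u2 z.
  by case/cycleP=> n ->; apply/commuteX/commuteM; apply: commute_sym.
have s2v y : y \in <[v]> -> commute s2 y.
  by case/cycleP=> n ->; apply/commuteX/commuteM => //; apply: commute_sym.
have u0v y : y \in <[v]> -> commute u0 y.
  by case/cycleP=> n ->; apply/commuteX/commuteM => //; apply: commute_sym.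
have cN x y : commute x y -> x \in 'N(<[y]>).
  by move=> cxy; apply: (subsetP (cent_sub _)); rewrite cent_cycle; apply/cent1P.
(* Normal form in the product of the factors generated by [s0, u2] and [s2, u0]. The rotations [v]
   and [t] are even words, so the parity is that of [k] plus [l]. *)
pose P (e : bool) (h : gT) := exists y z k (l : bool), [/\ y \in <[v]>, z \in <[t]>,
  h = y * s0 ^+ (k : bool) * (z * s2 ^+ l) & k (+) l = e].
have sb (x : gT) (n : bool) : x ^+ 2 = 1 -> x * x ^+ n = x ^+ (~~ n).
  by case: n => x2; [exact: x2 | rewrite /= expg0 mulg1].
have s0y y : y \in <[v]> -> s0 * y = y^-1 * s0 by apply: invol_mulC.
have s2z z : z \in <[t]> -> s2 * z = z^-1 * s2 by apply: invol_mulC.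
have u2y y : y \in <[v]> -> u2 * y = (v * y)^-1 * s0.
  move=> yv; rewrite -s0y.
  by rewrite mulgA invol_mulK.
  by rewrite groupM ?cycle_id.
have u0z z : z \in <[t]> -> u0 * z = (t * z)^-1 * s2.
  move=> zt; rewrite -s2z.
  by rewrite mulgA invol_mulK.
  by rewrite groupM ?cycle_id.
have Pmul e a h : a \in generators (Quadruple s0 s2 u0 u2) -> P e h -> P (~~ e) (a * h).
  move=> /letterP[l ->] [y [z [k [l' [yv zt -> <-]]]]].
  case: l => [[] []] /=.
  - exists (v * y)^-1, z, (~~ k), l'; rewrite groupV groupM ?cycle_id //; split=> //.
      by rewrite !mulgA u2y // -!mulgA -(sb s0) ?mulgA.
    by case: k l' => [] [].
  - exists y, (t * z)^-1, k, (~~ l'); rewrite groupV groupM ?cycle_id //; split=> //.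
      have cu0 : commute u0 (y * s0 ^+ k).
        by apply: commuteM; [apply: u0v | apply/commuteX/commute_sym].
      by rewrite mulgA cu0 -mulgA (mulgA u0) u0z // -(sb s2) ?mulgA.
    by case: k l' => [] [].
  - exists y, z^-1, k, (~~ l'); rewrite groupV; split=> //.
      have cs2 : commute s2 (y * s0 ^+ k).
        by apply: commuteM; [apply: s2v | apply/commuteX/commute_sym].
      by rewrite mulgA cs2 -mulgA (mulgA s2) s2z // -(sb s2) ?mulgA.
    by case: k l' => [] [].
  exists y^-1, z, (~~ k), l'; rewrite groupV; split=> //.
    by rewrite !mulgA s0y // -(sb s0) ?mulgA.
  by case: k l' => [] [].
move/(even_word_ind (P := P)); case=> //.
  by exists 1, 1, false, false; rewrite !group1 !mulg1.
move=> y [z [k [l [yv zt]]]]; rewrite /=; case: k l => [] [] //; rewrite ?mulg1 => r0E _.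
  (* Parity forces [k = l]. If both are odd, cancelling [s0] puts the reflection [z * s2] of the
     second factor in [<[v]>]: the outcome is the dual or the twin. *)
  have zv : z * s2 \in <[v]>.
    have szC : commute s0 (z * s2) by apply: commuteM => //; apply: s0t.
    suff yzs : y * (z * s2) = 1 by rewrite -(groupMl _ yv) yzs group1.
    apply: (mulIg s0); rewrite -mulgA -szC mulgA mul1g [RHS]r0E /=.
    by rewrite !expg1.
  have [||s2v'|u0v'] := reflection_mem s22 u02 _ _ zt zv.
  - by apply/cN/s2v/cycle_id.
  - by apply/cN/u0v/cycle_id.
  - exists (dual (Quadruple s0 s2 u0 u2)); split; first exact/TwinDualDual/TwinDualRefl.
    + exact: square_dual.
    + exact: genD.
    by [].
  exists (twin (Quadruple s0 s2 u0 u2)); split; first exact/TwinDualTwin/TwinDualRefl.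
  - exact: square_twin.
  - exact: genT.
  rewrite /= -[u2 * s0](_ : v^-1 = _) ?cycleV //.
  by rewrite invMg (invol_invg s02) (invol_invg u22).
(* If both are even, the reflection [y^-1 * s0] of the first factor lies in [<[t]>]: the outcome is
   the given quadruple or the dual of its twin. *)
have yt : y^-1 * s0 \in <[t]> by rewrite r0E mulKg.
have [|||s0t'|u2t'] := reflection_mem s02 u22 _ _ _ yt; rewrite ?groupV //.
- by apply/cN/s0t/cycle_id.
- by apply/cN/u2t/cycle_id.
- exists (Quadruple s0 s2 u0 u2); split=> //; exact: TwinDualRefl.
exists (dual (twin (Quadruple s0 s2 u0 u2))); split.
- exact/TwinDualDual/TwinDualTwin/TwinDualRefl.
- exact/square_dual/square_twin.
- by rewrite genD genT.
rewrite /= -[u0 * s2](_ : t^-1 = _) ?cycleV //.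
by rewrite invMg (invol_invg s22) (invol_invg u02).
Qed.

(** * Cases of the Euler equation *)

Lemma euclidean_triangles (m n : nat) :
  (0 < m)%N -> (0 < n)%N -> (2 * (m + n) = m * n)%N ->
  [\/ m = 4 /\ n = 4, m = 3 /\ n = 6 | m = 6 /\ n = 3]%N.
Proof.
move=> m0 n0 mn.
have m3 : (2 < m)%N by case: m m0 mn => [|[|[|m]]] //; lia.
have n3 : (2 < n)%N by case: n n0 mn => [|[|[|n]]] //; lia.
have m6 : (m <= 6)%N by nia.
have : m \in [:: 3; 4; 5; 6]%N by rewrite !inE; lia.
rewrite !inE => /or4P[] /eqP mE; move: mn; rewrite mE => mn.
- by constructor 2; lia.
- by constructor 1; lia.
- by exfalso; lia.
by constructor 3; lia.
Qed.

Lemma euclidean_square (m n : nat) :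
  (0 < m)%N -> (0 < n)%N -> (m + n = m * n)%N -> m = 2 /\ n = 2.
Proof.
case: m n => [|[|[|m]]] [|[|[|n]]] //; nia.
Qed.

(** The case of semi-edges in one colour only: [r] is the single generator of that colour, [s] and
    [u] are those of the other. *)
Lemma euclidean_semi_edge_orientable (gT : finGroupType) (r s u : gT) :
    r ^+ 2 = 1 -> s ^+ 2 = 1 -> u ^+ 2 = 1 -> (s * u) ^+ 2 = 1 ->
    (2 * (#[r * u] + #[r * s]) = #[r * u] * #[r * s])%N ->
  r \notin <<[set r; s; u] * [set r; s; u]>>.
Proof.
move=> r2 s2 u2 su2 /(euclidean_triangles (order_gt0 _) (order_gt0 _)).
case=> -[oru ors]; first exact: triangle_244_orientable.
  (* Orders 3 and 6 are interchanged by swapping [s] and [u]. *)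
  rewrite setUAC; apply: triangle_236_orientable => //.
  by rewrite -(commute_invol s2) // invol_commute //; apply: commute_invol.
exact: triangle_236_orientable.
Qed.

Lemma klein_group_presentation (gT : finGroupType) (G : {group gT}) (q : quadruple gT)
    (m := #[r2 q * rho2 q]) (n := #[r0 q * rho0 q]) :
    G :=: <<generators q>> -> (forall l, letter q l ^+ 2 = 1 /\ letter q l != 1) ->
    (r0 q * r2 q) ^+ 2 = 1 -> (rho0 q * rho2 q) ^+ 2 = 1 ->
    generators q \subset <<generators q * generators q>> ->
    (2 * (m + n) = ((r0 q != r2 q) + (rho0 q != rho2 q)) * (m * n))%N ->
  exists q' a b, [/\ twin_dual_related q q', (0 < a)%N, b \in [:: 1; 2]%N &
                     presented_by G q' (klein_relations a b)].
Proof.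
rewrite {}/m {}/n; case: q => s0 s2 u0 u2 /= GE lP c02 cu Q_even.
have [s02 s01] := lP (false, false); have [s22 s21] := lP (false, true).
have [u02 u01] := lP (true, false); have [u22 u21] := lP (true, true).
move: s02 s01 s22 s21 u02 u01 u22 u21 => /= s02 s01 s22 s21 u02 u01 u22 u21.
have [mgt0 ngt0] : (0 < #[s2 * u2])%N /\ (0 < #[s0 * u0])%N by [].
have [e0|ne0] := eqVneq s0 s2; have [e1|ne1] := eqVneq u0 u2; rewrite /= => mn.
(* Semi-edges in both colours: the right side of [mn] vanishes while the left is positive. *)
- lia.
- have /negP[] : s0 \notin <<[set s0; u0; u2] * [set s0; u0; u2]>>.
    apply: euclidean_semi_edge_orientable => //; move: mn.
    by rewrite add0n mul1n -e0 addnC mulnC [X in _ = X]mulnC; lia.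
  move: Q_even; rewrite /generators /= -e0 setUid !subUset !sub1set.
  by case/andP => /andP[].
- have oC (x y : gT) : x ^+ 2 = 1 -> y ^+ 2 = 1 -> #[x * y] = #[y * x].
    by move=> x2 y2; rewrite -orderV invMg !invol_invg.
  have /negP[] : u0 \notin <<[set u0; s0; s2] * [set u0; s0; s2]>>.
    apply: euclidean_semi_edge_orientable => //; move: mn.
    by rewrite -e1 (oC u0) // (oC u0) //; lia.
  have genE : generators (Quadruple s0 s2 u0 u2) = [set u0; s0; s2].
    by rewrite /generators /= -e1 -setUA setUid setUC setUA.
  by rewrite -genE; apply: (subsetP Q_even); rewrite genE !inE eqxx.
(* No semi-edges: the equation is 1/m + 1/n = 1. *)
have [m2 n2] : #[s2 * u2] = 2 /\ #[s0 * u0] = 2.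
  by apply: euclidean_square => //; lia.
have qS : square_lattice_quotient (Quadruple s0 s2 u0 u2).
  have ne_order2 (x y : gT) : #[x * y] = 2 -> y ^+ 2 = 1 -> x != y.
    by move=> oxy y2; apply: contra_eq_neq oxy => ->; rewrite -[y * y]/(y ^+ 2) y2 order1.
  have c1 (x y : gT) : x ^+ 2 = 1 -> y ^+ 2 = 1 -> #[x * y] = 2 -> commute x y.
    by move=> x2 y2 oxy; apply: commute_invol => //; rewrite -oxy expg_order.
  split=> //.
  - by split; [apply: commute_invol..|apply: c1|apply: c1].
  by split=> //; apply: ne_order2.
have r0_even := subsetP Q_even s0 ltac:(by rewrite !inE eqxx).
have [q' [qq' qS' genq' r0t]] := square_nonorientable qS r0_even.
rewrite -genq' in GE.
have [a [b [a0 b12 pres]]] := square_presentation GE qS' r0t.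
by exists q', a, b.
Qed.

(** * Colour-preserving automorphisms of a map *)

Section OrbitCounting.

Variables (F : finType) (D : {set {perm F}}) (A : {set F}).
Hypothesis D_stable : forall d z, d \in D -> z \in A -> d z \in A.

Lemma gen_acts : [acts <<D>>, on A | 'P].
Proof.
rewrite gen_subG; apply/subsetP=> d dD; rewrite !inE.
by apply/subsetP=> z zA; rewrite inE; apply: D_stable.
Qed.

Lemma orbit_gen_subset z : z \in A -> orbit 'P <<D>> z \subset A.
Proof. by rewrite (acts_sub_orbit _ gen_acts). Qed.

Lemma card_uniform_orbits c : {in A, forall z, #|orbit 'P <<D>> z| = c} ->
  #|A| = (#|orbit 'P <<D>> @: A| * c)%N.
Proof.
move=> cA; apply: card_uniform_partition (orbit_partition gen_acts).
by move=> _ /imsetP[z zA ->]; apply: cA.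
Qed.

End OrbitCounting.

Lemma mem_orbit_gen (F : finType) (D : {set {perm F}}) (d : {perm F}) z w :
  d \in D -> w \in orbit 'P <<D>> z -> d w \in orbit 'P <<D>> z.
Proof.
move=> dD /orbitP[g gD <-]; apply/orbitP; exists (g * d); last by rewrite /= /aperm permM.
by rewrite groupM // mem_gen.
Qed.

Section ColouredMap.

Variables (F : finType) (M : surface_map F) (S : {set F}) (x : F).
Variable q : quadruple {perm F}.
Hypothesis M_biregular : edge_biregular M S.
Hypothesis x_shaded : x \in S.
Hypothesis q_gens : distinguished_generators M S x q.

Local Notation H := (colour_aut M S).
Local Notation f0 := (flip0 M).
Local Notation f1 := (flip1 M).
Local Notation f2 := (flip2 M).
Local Notation y := (f1 x).

Lemma colour_autP h : h \in H ->
  [/\ forall z, f0 (h z) = h (f0 z), forall z, f1 (h z) = h (f1 z),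
      forall z, f2 (h z) = h (f2 z) & forall z, (h z \in S) = (z \in S)].
Proof.
rewrite inE => /andP[/centP cH hS].
have c f : f \in [set f0; f1; f2] -> forall z, f (h z) = h (f z).
  by move=> fM z; rewrite -permM (cH _ fM) permM.
split; try by apply: c; rewrite !inE eqxx ?orbT.
by move=> z; rewrite -(astabs_act z hS).
Qed.

Lemma flip1_shaded z : (f1 z \in S) = (z \notin S).
Proof. by have [/(_ z)[]] := M_biregular. Qed.

Lemma flip0_shaded z : (f0 z \in S) = (z \in S).
Proof. by have [/(_ z)[]] := M_biregular. Qed.

Lemma flip2_shaded z : (f2 z \in S) = (z \in S).
Proof. by have [/(_ z)[]] := M_biregular. Qed.

(** A corner has one flag of each colour, so the action of [h] on corners determines its action on
    flags. *)
Lemma colour_aut_corner h z w : h \in H -> (z \in S) = (w \in S) ->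
  h @: corner M z = corner M w -> h z = w.
Proof.
move=> /colour_autP[_ _ _ hS] zw hzw.
have : h z \in corner M w by rewrite -hzw imset_f // !inE eqxx.
rewrite !inE => /orP[/eqP //|/eqP hzE].
by move: (hS z); rewrite hzE flip1_shaded -zw; case: (z \in S).
Qed.

Lemma colour_aut_semiregular h z : h \in H -> h z = z -> h = 1.
Proof.
move=> hH hz; have [_ _ stab1] := M_biregular.
have cz : corner M z \in corners M by apply: imset_f.
apply/set1P; rewrite -[[set 1]]/(1%g : {set _}) -(stab1 _ cz) inE hH; apply/astab1P.
have [_ h1 _ _] := colour_autP hH.
by rewrite /= /setact /corner imsetU1 imset_set1 /= /aperm -h1 hz.
Qed.

Lemma colour_aut_inj h g z : h \in H -> g \in H -> h z = g z -> h = g.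
Proof.
move=> hH gH hgz; apply: (mulIg g^-1); rewrite mulgV.
apply: (@colour_aut_semiregular _ z); first by rewrite groupM ?groupV.
by rewrite permM hgz permK.
Qed.

(** With semiregularity, this identifies shaded flags with [H] through [h x]; unshaded flags
    correspond to [h y]. *)
Lemma colour_aut_shaded z : z \in S -> exists2 h, h \in H & z = h x.
Proof.
move=> zS; have [_ tr _] := M_biregular.
have xc : corner M x \in corners M by apply: imset_f.
have zc : corner M z \in corners M by apply: imset_f.
have [h hH hzx] := atransP2 tr xc zc; exists h => //.
by apply/esym/colour_aut_corner; rewrite ?x_shaded.
Qed.

Lemma colour_aut_unshaded z : z \notin S -> exists2 h, h \in H & z = h y.
Proof.
move=> zS; have [|h hH f1zE] := @colour_aut_shaded (f1 z); first by rewrite flip1_shaded.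
exists h => //; have [_ h1 _ _] := colour_autP hH.
by rewrite -h1 -f1zE flip1K.
Qed.

Lemma q_gensE : [/\ r0 q x = f0 x, r2 q x = f2 x, rho0 q y = f0 y & rho2 q y = f2 y].
Proof.
case: q_gens => [[q0 q2 u0 u2]] e0 e2 e0' e2'.
have yE : corner M x = corner M y by rewrite /corner flip1K setUC.
split; apply: colour_aut_corner; rewrite ?flip0_shaded ?flip2_shaded //; by rewrite -yE.
Qed.

Lemma letter_colour_aut l : letter q l \in H.
Proof. by case: q_gens => -[? ? ? ?] _ _ _ _; case: l => [[] []]. Qed.

(** Permutations compose from left to right, so under the identification of flags with [H] the flips
    along and across edges are left multiplications by generators. *)
Lemma flip_shaded h : h \in H ->
  [/\ f0 (h x) = (r0 q * h) x, f2 (h x) = (r2 q * h) x,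
      f0 (h y) = (rho0 q * h) y & f2 (h y) = (rho2 q * h) y].
Proof.
move=> /colour_autP[h0 _ h2 _]; have [e0 e2 e0' e2'] := q_gensE.
by rewrite h0 h2 h0 h2 !permM e0 e2 e0' e2'.
Qed.

Lemma letter_neq1 l : letter q l != 1.
Proof.
have [e0 e2 e0' e2'] := q_gensE.
case: l => [[] []]; apply/eqP=> /= /(congr1 (fun h : {perm F} => (h x, h y)));
  rewrite !perm1 => -[]; rewrite ?e0 ?e2 ?e0' ?e2'.
- by move=> _ /eqP; rewrite (negPf (flip2_free M _)).
- by move=> _ /eqP; rewrite (negPf (flip0_free M _)).
- by move=> /eqP; rewrite (negPf (flip2_free M _)).
by move=> /eqP; rewrite (negPf (flip0_free M _)).
Qed.

(** By semiregularity an identity in [H] need only be checked at one flag: [x] for shaded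
    generators, [y] for unshaded ones. *)
Lemma letter_invol l : letter q l ^+ 2 = 1.
Proof.
have lH := letter_colour_aut l.
case: l lH => [[] []] lH; [apply: (@colour_aut_inj _ _ y)|apply: (@colour_aut_inj _ _ y)
  |apply: (@colour_aut_inj _ _ x)|apply: (@colour_aut_inj _ _ x)];
  rewrite ?group1 ?groupX // perm1 expgS expg1 /=; have [e0 e2 e0' e2'] := q_gensE;
  have [E0 E2 E0' E2'] := flip_shaded lH; rewrite -?E0 -?E2 -?E0' -?E2' /=
    ?e0 ?e2 ?e0' ?e2' ?flip0K ?flip2K //.
Qed.

Lemma letter_commute : commute (r0 q) (r2 q) /\ commute (rho0 q) (rho2 q).
Proof.
have [q0 q2] := (letter_colour_aut (false, false), letter_colour_aut (false, true)).
have [u0 u2] := (letter_colour_aut (true, false), letter_colour_aut (true, true)).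
have [e0 e2 e0' e2'] := q_gensE; have fC := flip02_comm M.
split; [apply: (@colour_aut_inj _ _ x) | apply: (@colour_aut_inj _ _ y)];
  rewrite ?groupM //.
  have [_ <- _ _] := flip_shaded q0; have [<- _ _ _] := flip_shaded q2.
  by rewrite /= e0 e2 fC.
have [_ _ _ <-] := flip_shaded u0; have [_ _ <- _] := flip_shaded u2.
by rewrite /= e0' e2' fC.
Qed.

Lemma flips_stable_setT (A : {set F}) z : x \in A ->
    (forall w, w \in A -> [/\ f0 w \in A, f1 w \in A & f2 w \in A]) ->
  z \in A.
Proof.
move=> xA Af; have /subsetP : orbit 'P <<[set f0; f1; f2]>> x \subset A.
  apply: orbit_gen_subset => // d w dM wA; have [? ? ?] := Af w wA.
  by move: dM; rewrite !inE => /orP[/orP[]|] /eqP->.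
by apply; rewrite (atransP (map_connected M)) ?inE.
Qed.

(** The flags [g x] and [g y], with [g] in the generated subgroup, are closed under flips and so, by
    connectedness, are all flags. Hence [h x] is some [g x], the colour excluding [g y], and
    [h = g]. *)
Lemma colour_autE : H :=: <<generators q>>.
Proof.
apply/eqP; rewrite eqEsubset andbC gen_subG.
have sgH : generators q \subset H.
  by apply/subsetP=> _ /letterP[l ->]; apply: letter_colour_aut.
rewrite sgH; apply/subsetP=> h hH.
pose A := [set z | [exists g in <<generators q>>, (z == g x) || (z == g y)]].
have AP g : g \in <<generators q>> -> g x \in A /\ g y \in A.
  by move=> gG; rewrite !inE; split; apply/exists_inP; exists g; rewrite ?eqxx ?orbT.
have lG l g : g \in <<generators q>> -> letter q l * g \in <<generators q>>.
  by move=> gG; rewrite groupM // mem_gen //; apply/letterP; exists l.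
have sGH : {subset <<generators q>> <= H} by apply/subsetP; rewrite gen_subG.
have : h x \in A.
  apply: flips_stable_setT => [|w]; first by have [] := AP 1 (group1 _); rewrite perm1.
  rewrite inE => /exists_inP[g gG /orP[] /eqP->];
    have [_ g1 _ _] := colour_autP (sGH _ gG);
    have [E0 E2 E0' E2'] := flip_shaded (sGH _ gG); rewrite g1 ?flip1K.
    by rewrite E0 E2; split; [case: (AP _ (lG (false, false) g gG))|case: (AP g gG)|
      case: (AP _ (lG (false, true) g gG))].
  by rewrite E0' E2'; split; [case: (AP _ (lG (true, false) g gG))|case: (AP g gG)|
    case: (AP _ (lG (true, true) g gG))].
rewrite inE => /exists_inP[g gG /orP[] /eqP hg].
  by rewrite (colour_aut_inj hH (sGH _ gG) hg).
have [_ _ _ hS] := colour_autP hH; have [_ _ _ gS] := colour_autP (sGH _ gG).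
by move: (hS x); rewrite hg gS flip1_shaded x_shaded.
Qed.

Lemma card_shaded : #|S| = #|H| /\ #|~: S| = #|H|.
Proof.
have inj z : {in H &, injective (fun h : {perm F} => h z)}.
  by move=> h g hH gH; apply: colour_aut_inj.
split; [rewrite -(card_in_imset (inj x)) | rewrite -(card_in_imset (inj y))];
  apply: eq_card => z; apply/idP/imsetP.
- by case/colour_aut_shaded=> h; exists h.
- by case=> h /colour_autP[_ _ _ hS] ->; rewrite hS.
- by rewrite inE => /colour_aut_unshaded[h]; exists h.
by case=> h /colour_autP[_ _ _ hS] ->; rewrite inE hS flip1_shaded negbK.
Qed.

(** * Counting vertices, faces and edges *)

(** Used with [f2] for vertices and [f0] for faces. The orbit of [h x] consists of the flags
    [(k * h) x] and [(k * h) y] with [k] in [K], disjoint by colour. *)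
Lemma card_dihedral_orbit (f a b : {perm F}) :
    (forall h, h \in H -> f (h x) = (a * h) x /\ f (h y) = (b * h) y) ->
    a \in H -> b \in H ->
  {in [set: F], forall z, #|orbit 'P <<[set f1; f]>> z| = (2 * #|<<[set a; b]>>|)%N}.
Proof.
move=> fE aH bH z _; set K := <<[set a; b]>>; set O := orbit _ _.
have sKH : {subset K <= H}.
  by apply/subsetP; rewrite gen_subG; apply/subsetP=> c /set2P[] ->.
have [aK bK] : a \in K /\ b \in K by rewrite !mem_gen // !inE eqxx ?orbT.
have Of1 w v : w \in O v -> f1 w \in O v by apply: mem_orbit_gen; rewrite !inE eqxx.
have Of w v : w \in O v -> f w \in O v by apply: mem_orbit_gen; rewrite !inE eqxx orbT.
wlog zS : z / z \in S.
  move=> IH; have [/IH //|zS] := boolP (z \in S).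
  rewrite -(IH (f1 z)) ?flip1_shaded // (_ : O z = O (f1 z)) //.
  by apply/orbit_eqP; rewrite -{1}[z](flip1K M); apply/Of1/orbit_refl.
have [h hH ->] := colour_aut_shaded zS.
have inj w : {in K &, injective (fun k : {perm F} => (k * h) w)}.
  move=> k l kK lK klw; apply: (mulIg h).
  by apply: colour_aut_inj klw; apply: groupM => //; apply: sKH.
pose X := [set (k * h) x | k in K]; pose Y := [set (k * h) y | k in K].
have XS w : w \in X -> w \in S.
  case/imsetP=> k kK ->; have [_ _ _ ->] := colour_autP (groupM (sKH k kK) hH).
  exact: x_shaded.
have YS w : w \in Y -> w \notin S.
  case/imsetP=> k kK ->; have [_ _ _ ->] := colour_autP (groupM (sKH k kK) hH).
  by rewrite flip1_shaded x_shaded.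
suff -> : O (h x) = X :|: Y.
  rewrite cardsU (_ : X :&: Y = set0) ?cards0 ?subn0.
    by rewrite !card_in_imset // addnn mul2n.
  by apply/setP=> w; rewrite !inE; apply/negP=> /andP[/XS wS /YS]; rewrite wS.
have kh1 k : k \in K -> f1 ((k * h) x) = (k * h) y.
  by move=> kK; have [_ -> _ _] := colour_autP (groupM (sKH k kK) hH).
have khf k : k \in K ->
    f ((k * h) x) = (a * k * h) x /\ f ((k * h) y) = (b * k * h) y.
  by move=> kK; rewrite -!(mulgA _ k); apply/fE/groupM => //; apply: sKH.
have XI k : k \in K -> (k * h) x \in X by apply: (imset_f (fun k => (k * h) x)).
have YI k : k \in K -> (k * h) y \in Y by apply: (imset_f (fun k => (k * h) y)).
apply/eqP; rewrite eqEsubset; apply/andP; split.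
  apply: orbit_gen_subset => [d w|].
    rewrite !inE => /orP[] /eqP-> /orP[] /imsetP[k kK ->]; apply/orP.
    - by right; rewrite kh1 ?YI.
    - by left; rewrite -kh1 // flip1K XI.
    - by left; have [-> _] := khf k kK; rewrite XI ?groupM.
    by right; have [_ ->] := khf k kK; rewrite YI ?groupM.
  by rewrite inE -[h]mul1g XI.
have XO k : k \in K -> (k * h) x \in O (h x) /\ (k * h) y \in O (h x).
  move=> kK; suff kO : (k * h) x \in O (h x) by split=> //; rewrite -kh1 // Of1.
  have: k \in K /\ (k * h) x \in O (h x); last by case.
  elim/gen_mulg_ind: k / kK => [|c k].
    by rewrite group1 mul1g orbit_refl.
  rewrite !inE => cab [kK kO]; split; first by rewrite groupM //; case/orP: cab => /eqP->.
  case/orP: cab => /eqP->; have [fx fy] := khf k kK; first by rewrite -fx Of.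
  (* Multiplication by [b] is [f] on unshaded flags, so on shaded ones it is reached through [f1],
     [f], [f1]. *)
  rewrite -[(b * k * h) x](flip1K M) kh1 ?groupM // -fy -kh1 //.
  by apply/Of1/Of/Of1.
by apply/subsetP=> w; rewrite inE => /orP[] /imsetP[k kK ->]; case: (XO k kK).
Qed.

(** An ordinary edge has four flags. By regularity the flags of one colour all lie on ordinary
    edges, or all on semi-edges, according to the two generators of that colour. *)
Lemma card_ordinary_edges :
  (#|edges M :\: semi_edges M| * 4 = ((r0 q != r2 q) + (rho0 q != rho2 q)) * #|H|)%N.
Proof.
pose N := [set z | f0 z != f2 z].
have NP z : (z \in N) = (f0 z != f2 z) by rewrite inE.
have Nst d z : d \in [set f0; f2] -> z \in N -> d z \in N.
  rewrite !NP => /set2P[] -> nz; rewrite ?flip0K ?flip2K.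
    by rewrite -flip02_comm eq_sym (can2_eq (flip0K M) (flip0K M)) eq_sym.
  by rewrite (can2_eq (flip0K M) (flip0K M)) eq_sym.
have -> : edges M :\: semi_edges M = orbit 'P <<[set f0; f2]>> @: N.
  apply/setP=> E; rewrite !inE; apply/andP/imsetP => [[]|[z zN ->]].
    rewrite andbC => /nandP nE /imsetP[z _ EE]; exists z => //.
    rewrite NP; apply: contraT; rewrite negbK => fz; case: nE => /negP[].
      by apply/exists_inP; exists z; rewrite // EE orbit_refl.
    by apply/imsetP; exists z.
  split; last by apply/imsetP; exists z.
  rewrite negb_and; apply/orP; right; apply/exists_inP=> -[w wz].
  by apply/negP; rewrite -NP; apply: (subsetP (orbit_gen_subset Nst zN)).
rewrite -(card_uniform_orbits Nst) => [|z zN].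
  have [SE TE] := card_shaded.
  have NS z : z \in S -> (z \in N) = (r0 q != r2 q).
    case/colour_aut_shaded=> h hH ->; have [E0 E2 _ _] := flip_shaded hH.
    rewrite NP E0 E2; congr (~~ _); apply/eqP/eqP => [|-> //].
    move/colour_aut_inj; rewrite !groupM ?(letter_colour_aut (false, false)) //.
      by move=> /(_ isT isT)/mulIg.
    by rewrite (letter_colour_aut (false, true)).
  have NT z : z \notin S -> (z \in N) = (rho0 q != rho2 q).
    case/colour_aut_unshaded=> h hH ->; have [_ _ E0 E2] := flip_shaded hH.
    rewrite NP E0 E2; congr (~~ _); apply/eqP/eqP => [|-> //].
    move/colour_aut_inj; rewrite !groupM ?(letter_colour_aut (true, false)) //.
      by move=> /(_ isT isT)/mulIg.
    by rewrite (letter_colour_aut (true, true)).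
  rewrite -(cardsID S N) mulnDl; congr (_ + _)%N.
    have -> : N :&: S = if r0 q != r2 q then S else set0.
      apply/setP=> z; rewrite in_setI.
      by case: (boolP (z \in S)) => [/[dup] zS /NS->|/negPf zS]; rewrite ?andbF;
        case: ifP; rewrite ?inE ?zS.
    by case: ifP; rewrite ?SE ?cards0 ?mul1n ?mul0n.
  have -> : N :\: S = if rho0 q != rho2 q then ~: S else set0.
    apply/setP=> z; rewrite in_setD.
    by case: (boolP (z \in S)) => [zS|/[dup] zS /NT->];
      case: ifP; rewrite ?inE ?zS.
  by case: ifP; rewrite ?TE ?cards0 ?mul1n ?mul0n.
have zO := orbit_refl 'P <<[set f0; f2]>> z.
have [fz f02 f22] : [/\ f0 z != f2 z, f0 z != z & f2 z != z].
  by rewrite -NP zN flip0_free flip2_free.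
(* These four flags are distinct and form the whole orbit of [z]. *)
have : uniq [:: z; f0 z; f2 z; f0 (f2 z)].
  rewrite /= !inE !negb_or (eq_sym z) f02 (eq_sym z) f22 fz.
  rewrite ![_ == f0 (f2 z)]eq_sym (can2_eq (flip0K M) (flip0K M)) eq_sym fz.
  rewrite (inj_eq perm_inj) f22 flip02_comm (inj_eq perm_inj) f02 //.
move/card_uniqP => /= <-; apply/eqP; rewrite eqn_leq; apply/andP; split.
  rewrite -[X in (_ <= X)%N]cardsE; apply/subset_leq_card/orbit_gen_subset.
    move=> d w dD; rewrite !inE => /or4P[] /eqP->; case/set2P: dD => ->;
      by rewrite ?flip0K ?flip2K -?flip02_comm ?flip2K ?flip0K ?eqxx ?orbT.
  by rewrite !inE eqxx.
apply/subset_leq_card/subsetP=> w.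
have O d v : d \in [set f0; f2] -> v \in orbit 'P <<[set f0; f2]>> z ->
  d v \in orbit 'P <<[set f0; f2]>> z by apply: mem_orbit_gen.
have [O0 O2] := (O f0 ^~ (set21 _ _), O f2 ^~ (set22 _ _)).
by rewrite !inE => /or4P[] /eqP->; rewrite ?O0 ?O2.
Qed.

Lemma euler_formula : euler_characteristic_zero M ->
  (2 * (#[r2 q * rho2 q] + #[r0 q * rho0 q]) =
   ((r0 q != r2 q) + (rho0 q != rho2 q)) * (#[r2 q * rho2 q] * #[r0 q * rho0 q]))%N.
Proof.
set m := #[_]; set n := #[_]; set e := (nat_of_bool _ + _)%N.
rewrite /euler_characteristic_zero => euler.
have FE : #|[set: F]| = (2 * #|H|)%N.
  by have [SE TE] := card_shaded; rewrite cardsT -(cardsC S) SE TE addnn mul2n.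
have [[lI l1] lH] := (letter_invol, letter_neq1, letter_colour_aut).
have VE : (#|vertices M| * (2 * m))%N = #|H|.
  have fE h : h \in H -> f2 (h x) = (r2 q * h) x /\ f2 (h y) = (rho2 q * h) y.
    by case/flip_shaded.
  have D := card_dihedral_orbit fE (lH (false, true)) (lH (true, true)).
  have := card_uniform_orbits (fun _ z _ _ => in_setT _) D; rewrite FE.
  have I2 := (lI (false, true), l1 (false, true)).
  have J2 := (lI (true, true), l1 (true, true)).
  rewrite card_gen_involutions ?I2 ?J2 // mulnCA => /eqP.
  by rewrite eqn_pmul2l // => /eqP->.
have FaE : (#|faces M| * (2 * n))%N = #|H|.
  have fE h : h \in H -> f0 (h x) = (r0 q * h) x /\ f0 (h y) = (rho0 q * h) y.
    by case/flip_shaded.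
  have D := card_dihedral_orbit fE (lH (false, false)) (lH (true, false)).
  have := card_uniform_orbits (fun _ z _ _ => in_setT _) D; rewrite FE.
  have I0 := (lI (false, false), l1 (false, false)).
  have J0 := (lI (true, false), l1 (true, false)).
  rewrite card_gen_involutions ?I0 ?J0 // mulnCA => /eqP.
  by rewrite eqn_pmul2l // => /eqP->; rewrite /faces setUC.
have EE : (#|edges M :\: semi_edges M| * 4)%N = (e * #|H|)%N.
  exact: card_ordinary_edges.
have SE : (#|semi_edges M| + #|edges M :\: semi_edges M| = #|edges M|)%N.
  rewrite -(cardsID (semi_edges M) (edges M)); congr (_ + _)%N.
  by apply: eq_card => E; rewrite !inE andbA andbb.
have Hgt0 : (0 < #|H|)%N := cardG_gt0 _.
move: euler VE FaE EE SE Hgt0.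
move: #|vertices _| #|semi_edges _| #|faces _| #|edges _| #|_ :\: _| #|H| => V s Fa E N h.
move: m n e => {FE lI l1 lH} m n e VEF Vm Fn Ne SEN h0.
(* The dangling ends cancel the semi-edges in the Euler equation. *)
have NE : N = (V + Fa)%N by lia.
have Vmn := congr1 (muln (2 * n)) Vm; have Fmn := congr1 (muln (2 * m)) Fn.
apply/eqP; rewrite -(eqn_pmul2r h0); apply/eqP.
have := congr1 (muln (m * n)) Ne; rewrite NE; lia.
Qed.

(** * Orientability and parity of words *)

(** If some generator [g] is not an even word, then no generator is, and the even words form a
    subgroup of index two, from which an orientation is built. *)
Lemma nonorientable_even : ~ orientable M ->
  generators q \subset <<generators q * generators q>>.
Proof.
move=> nonor; apply: contraT => /subsetPn[g gq gE]; case: nonor.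
set E := <<_>> in gE; pose Q := generators q.
have QE a b : a \in Q -> b \in Q -> a * b \in E.
  by move=> aQ bQ; rewrite mem_gen // mem_mulg.
have Q2 a : a \in Q -> a ^+ 2 = 1 by case/letterP=> l ->; apply: letter_invol.
have QnE a : a \in Q -> a \notin E.
  by move=> aQ; rewrite -(groupMl _ (QE g a gq aQ)) -mulgA -[a * a]/(a ^+ 2) Q2 ?mulg1.
have QH a : a \in Q -> a \in H by case/letterP=> l ->; apply: letter_colour_aut.
have coset h : h \in H -> h \in E \/ g * h \in E.
  rewrite colour_autE => hQ; elim/gen_mulg_ind: h / hQ => [|a h aQ]; first by left.
  case=> hE; [right | left]; first by rewrite mulgA groupM ?QE.
  by rewrite -[h](invol_mulK _ (Q2 g gq)) mulgA (groupMr _ hE) QE.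
have swap a h : a \in Q -> h \in H -> (a * h \in E) = (h \notin E).
  move=> aQ hH; have [hE|hE] := boolP (h \in E).
    by rewrite groupMr // (negPf (QnE a aQ)).
  case: (coset h hH) => [|ghE]; first by rewrite (negPf hE).
  by apply/idP; rewrite -[h](invol_mulK _ (Q2 g gq)) mulgA (groupMr _ ghE) QE.
(* [h y] is the [f1]-neighbour of [h x], so it must be on the opposite side: [o] takes [h x] for
   even [h] and [h y] for odd [h]. *)
pose o := [set z | [exists h in H, if h \in E then z == h x else z == h y]].
have ox h : h \in H -> (h x \in o) = (h \in E).
  move=> hH; rewrite inE; apply/exists_inP/idP => [[k kH]|hE]; last first.
    by exists h; rewrite ?hE.
  case: ifP => [kE /eqP /colour_aut_inj -> //|_ /eqP hk].
  have [_ _ _ hS] := colour_autP hH; have [_ _ _ kS] := colour_autP kH.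
  by move: (hS x); rewrite hk kS flip1_shaded x_shaded.
have oy h : h \in H -> (h y \in o) = (h \notin E).
  move=> hH; rewrite inE; apply/exists_inP/idP => [[k kH]|hE]; last first.
    by exists h; rewrite ?(negPf hE).
  case: ifP => [_ /eqP hk|kE /eqP /colour_aut_inj -> //]; last by rewrite kE.
  have [_ _ _ hS] := colour_autP hH; have [_ _ _ kS] := colour_autP kH.
  by move: (hS y); rewrite hk kS flip1_shaded x_shaded.
exists o => z; have lQ l : letter q l \in Q by apply/letterP; exists l.
have [q0 q2] := (QH _ (lQ (false, false)), QH _ (lQ (false, true))).
have [u0 u2] := (QH _ (lQ (true, false)), QH _ (lQ (true, true))).
have [zS|zS] := boolP (z \in S).
  have [h hH ->] := colour_aut_shaded zS; have [E0 E2 _ _] := flip_shaded hH.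
  have [_ -> _ _] := colour_autP hH; rewrite E0 E2 oy // !ox //; try exact: groupM.
  by rewrite (swap (r0 q) _ (lQ (false, false))) // (swap _ _ (lQ (false, true))).
have [h hH ->] := colour_aut_unshaded zS; have [_ _ E0 E2] := flip_shaded hH.
have [_ -> _ _] := colour_autP hH; rewrite E0 E2 flip1K ox // !oy //; try exact: groupM.
rewrite (swap (rho0 q) _ (lQ (true, false))) // (swap _ _ (lQ (true, true))) //.
by rewrite negbK.
Qed.

End ColouredMap.

Theorem proposition4p4 (F : finType) (M : surface_map F) (S : {set F}) (x : F)
    (q : quadruple {perm F})
    (M_biregular : edge_biregular M S)
    (M_klein : on_klein_bottle M)
    (x_shaded : x \in S)
    (q_gens : distinguished_generators M S x q) :
  exists (q' : quadruple {perm F}) (a b : nat),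
    [/\ twin_dual_related q q', (0 < a)%N, b \in [:: 1; 2]%N &
        presented_by (colour_aut M S) q' (klein_relations a b)].
Proof.
have [nonorientableM eulerM] := M_klein.
have q_invol := letter_invol M_biregular q_gens.
have [c02 cu] := letter_commute M_biregular q_gens.
apply: klein_group_presentation.
- exact: colour_autE M_biregular x_shaded q_gens.
- by split; [apply: q_invol | apply: letter_neq1 M_biregular q_gens _].
- exact: invol_commute (q_invol (false, false)) (q_invol (false, true)) c02.
- exact: invol_commute (q_invol (true, false)) (q_invol (true, true)) cu.
- exact: nonorientable_even M_biregular x_shaded q_gens nonorientableM.
exact: euler_formula M_biregular x_shaded q_gens eulerM.
Qed.
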